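(* Let $\mu,\nu,\beta$ be real numbers with $\mu>-\frac{3}{2}$, $-\frac{1}{2}<\nu<\mu+1$ and $0<\beta<1$. Then, for all $x>0$, both of the following inequalities hold: $$\int_0^x\mathrm{e}^{-\beta u}u^\nu \tilde{t}_{\mu,\nu}(u)\,\mathrm{d}u<\frac{\mu+\nu+3+A_{\mu,\nu}}{(2\nu+1)(1-\beta)}\,\mathrm{e}^{-\beta x} x^\nu \tilde{t}_{\mu+1,\nu+1}(x),$$ $$\int_0^x\mathrm{e}^{-\beta u}u^\nu \tilde{t}_{\mu,\nu}(u)\,\mathrm{d}u<\frac{\mu+\nu+\frac{1}{2}(9+\sqrt{17})}{(2\nu+1)(1-\beta)}\,\mathrm{e}^{-\beta x}x^\nu \tilde{t}_{\mu+1,\nu+1}(x),$$ where $A_{\mu,\nu}=\frac{1}{2}(\mu-\nu)+\frac{1}{2}\sqrt{(\mu-\nu)^2+8(\mu+\nu+3)}$.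
   Context: For real $\mu,\nu$ and $x>0$, the (normalised) modified Lommel function of the first kind is $$\tilde{t}_{\mu,\nu}(x)=\sum_{k=0}^\infty\frac{(\frac{1}{2}x)^{\mu+2k+1}}{\Gamma\big(k+\frac{\mu-\nu+3}{2}\big)\Gamma\big(k+\frac{\mu+\nu+3}{2}\big)},$$ where $1/\Gamma$ is taken to be $0$ at the poles of $\Gamma$. *)

(* Defs.v *)
From Stdlib Require Import Reals ZArith.
From Coquelicot Require Import Coquelicot.
Open Scope R_scope.

(* Both ends are improper; this is the Gamma function only for [0 < s]. *)
Definition EulerGamma (s : R) : R :=
  RInt_gen (fun t : R => Rpower t (s - 1) * exp (- t))
    (at_right 0) (Rbar_locally p_infty).

Fixpoint rising (s : R) (n : nat) : R :=
  match n with
  | O => 1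
  | S m => rising s m * (s + INR m)
  end.

(* The entire function [1 / Gamma], obtained from the Euler integral through
   [Gamma (s + n) = s (s + 1) ... (s + n - 1) Gamma s] with the least [n] such
   that [0 < s + n].  For [0 < s] this [n] is [0]; at the poles
   [s = 0, -1, -2, ...] of Gamma the last factor of [rising s n] vanishes. *)
Definition rGamma (s : R) : R :=
  let n := Z.to_nat (up (- s)) in
  rising s n / EulerGamma (s + INR n).

Definition lommel_t (mu nu x : R) : R :=
  Series (fun k : nat =>
    Rpower (x / 2) (mu + 2 * INR k + 1)
    * (rGamma (INR k + (mu - nu + 3) / 2)
       * rGamma (INR k + (mu + nu + 3) / 2))).

Definition lommel_A (mu nu : R) : R :=
  (mu - nu) / 2 + sqrt ((mu - nu) ^ 2 + 8 * (mu + nu + 3)) / 2.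

Definition lommel_integrand (beta mu nu u : R) : R :=
  exp (- beta * u) * Rpower u nu * lommel_t mu nu u.

(* Main.v *)
Require Import Defs.
From Stdlib Require Import Reals.
From Coquelicot Require Import Coquelicot.
From Stdlib Require Import Lra Lia Psatz.
Open Scope R_scope.

(** Write [f = t_{mu,nu}], [g = t_{mu+1,nu+1}], [d = f - g], [n = nu + 1/2],
    [s = mu + nu + 3] and [E(x) = exp (- beta x)].

    The power series and [Gamma (s + 1) = s Gamma s] give the linear system
    [f' = (nu/x) f + g + p], [g' = f - ((nu+1)/x) g], where [p >= 0] is a multiple
    of [x^mu] (for Bessel functions [p] would be zero).  This system and the
    behaviour at 0 are all that is used afterwards; they are recorded in
    [lommel_system].

    Multiplying by suitable integrating factors, three comparisons of [f]
    with [g] follow from the system: [0 <= d], [n g/x <= d] and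
    [d <= s g/x] ([difference_nonneg], [difference_lower], [difference_upper]).

    The integral is then bounded by a trial function
    [U = E x^nu (q d + w g)] with [q, w >= 0] chosen so that
    [U' >= E x^nu f].  As [U >= 0], integrating from [e] to [x] bounds the
    integral over [(e, x)] by [U x], uniformly in [e]; this yields at once the
    existence of the improper integral and the bound, and [d <= s g/x] turns
    [U x] into a multiple of [E x^nu g] ([trial_bound]).

    For [nu >= 1/2] it is enough to take [q = 0] and [w] constant, which gives
    the constant [s] in place of the two constants of the theorem.  For [nu < 1/2]
    a constant [w] fails: when [beta] is near 1, [E x^nu g] behaves like
    [x^(nu-1/2)] for [x] between 1 and [1/(1-beta)]; there it decreases and cannot dominate the integral by its
    derivative.  When [beta = 1] and [p = 0] the choice [q = x/(2n)], [w = 2q] is exact;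
    letting [q] and [w] saturate at the scale [1/(1-beta)], that is, dividing
    such linear functions by [1 + eta x] with [eta] proportional to [1 - beta],
    gives the constant [max(s, 3n+2)].  In both cases the constant is strictly
    below [s + A] and [s + (3 + sqrt 17)/2]; for [3n+2 < s + A] this is
    [lommel_A_small_order]. *)

(** * Monotonicity and improper integrals of nonnegative functions *)

Lemma Rpower_pos (x y : R) : 0 < Rpower x y.
Proof. apply exp_pos. Qed.

Lemma Rpower_minus_1 (x y : R) : 0 < x -> Rpower x (y - 1) = Rpower x y / x.
Proof.
  intros hx. unfold Rminus. rewrite Rpower_plus, Rpower_Ropp, Rpower_1; trivial.
Qed.

Lemma Rpower_succ (x y : R) : 0 < x -> Rpower x (y + 1) = Rpower x y * x.
Proof. intros hx. rewrite Rpower_plus, Rpower_1; trivial. Qed.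

Lemma is_derive_Rpower (y x : R) : 0 < x ->
  is_derive (fun u => Rpower u y) x (y / x * Rpower x y).
Proof.
  intros hx.
  replace (y / x * Rpower x y) with (y * Rpower x (y - 1))
    by (rewrite Rpower_minus_1 by trivial; field; lra).
  apply is_derive_Reals, derivable_pt_lim_power, hx.
Qed.

(** Integrating factors [exp (k u) u^c] serve both for the comparisons of [f]
    with [g] and for the trial functions. *)
Lemma is_derive_weighted (k c : R) (y : R -> R) (x dy : R) : 0 < x ->
  is_derive y x dy ->
  is_derive (fun u => exp (k * u) * Rpower u c * y u) x
    (exp (k * x) * Rpower x c * (dy + (k + c / x) * y x)).
Proof.
  intros hx hy.
  assert (hp := is_derive_Rpower c x hx).
  auto_derive.
  - repeat split; eexists; eassumption.
  - replace (Derive (fun u : R => y u) x) with dy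
      by (symmetry; apply is_derive_unique, hy).
    replace (Derive (fun u : R => Rpower u c) x) with (c / x * Rpower x c)
      by (symmetry; apply is_derive_unique, hp).
    field. lra.
Qed.

Lemma le_of_derive_nonneg (F dF : R -> R) (a b : R) :
  0 < a -> a <= b ->
  (forall x, 0 < x -> is_derive F x (dF x)) ->
  (forall x, a <= x -> 0 <= dF x) ->
  F a <= F b.
Proof.
  intros ha hab hF hdF.
  destruct (MVT_gen F a b dF) as [c [hc heq]].
  - intros x hx. apply hF. rewrite Rmin_left in hx by trivial. lra.
  - intros x hx. rewrite Rmin_left in hx by trivial.
    apply continuity_pt_filterlim.
    apply (ex_derive_continuous F). eexists. apply hF. lra.
  - rewrite Rmin_left in hc by trivial.
    assert (0 <= dF c * (b - a)) by (apply Rmult_le_pos; [apply hdF|]; lra).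
    lra.
Qed.

(** A nondecreasing function on the positive half-line is nonnegative as soon
    as its lower limit at 0 is; a lower bound by a multiple of a positive power
    of [x] is the form in which that information is available here. *)
Lemma nonneg_of_derive_nonneg (F dF : R -> R) (M c : R) :
  0 < c ->
  (forall x, 0 < x -> is_derive F x (dF x)) ->
  (forall x, 0 < x -> 0 <= dF x) ->
  (forall x, 0 < x <= 1 -> - (M * Rpower x c) <= F x) ->
  forall x, 0 < x -> 0 <= F x.
Proof.
  intros hc hF hdF hM x hx.
  apply Rnot_lt_le; intros hneg.
  (* At the point [e] with [e^c = t] the lower bound [- M t] exceeds [F x],
     although [e <= x]. *)
  set (t := Rmin (Rmin 1 (Rpower x c)) (- F x / (2 * (Rabs M + 1)))).
  assert (hM0 := Rabs_pos M).
  assert (ht3 : 0 < - F x / (2 * (Rabs M + 1)))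
    by (apply Rdiv_lt_0_compat; lra).
  assert (ht : 0 < t) by (unfold t; repeat apply Rmin_pos; try lra; apply Rpower_pos).
  assert (ht1 : t <= 1 /\ t <= Rpower x c /\ t <= - F x / (2 * (Rabs M + 1))).
  { unfold t. repeat split.
    - eapply Rle_trans; [apply Rmin_l | apply Rmin_l].
    - eapply Rle_trans; [apply Rmin_l | apply Rmin_r].
    - apply Rmin_r. }
  destruct ht1 as [h1 [h2 h3]].
  set (e := Rpower t (/ c)).
  assert (hic : 0 <= / c) by (left; apply Rinv_0_lt_compat; trivial).
  assert (he : 0 < e) by apply Rpower_pos.
  assert (he1 : e <= 1).
  { replace 1 with (Rpower 1 (/ c)).
    - apply Rle_Rpower_l; lra.
    - unfold Rpower. rewrite ln_1, Rmult_0_r, exp_0. reflexivity. }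
  assert (hex : e <= x).
  { replace x with (Rpower (Rpower x c) (/ c)).
    - apply Rle_Rpower_l; lra.
    - rewrite Rpower_mult, Rinv_r, Rpower_1; lra. }
  assert (hec : Rpower e c = t).
  { unfold e. rewrite Rpower_mult, Rinv_l, Rpower_1; lra. }
  assert (hF1 := le_of_derive_nonneg F dF e x he hex hF
    (fun y hy => hdF y (Rlt_le_trans _ _ _ he hy))).
  assert (hF2 := hM e (conj he he1)).
  rewrite hec in hF2.
  assert (M * t <= Rabs M * t) by (apply Rmult_le_compat_r; [lra | apply Rle_abs]).
  apply (Rmult_le_compat_l (2 * (Rabs M + 1))) in h3; [| lra].
  replace (2 * (Rabs M + 1) * (- F x / (2 * (Rabs M + 1)))) with (- F x) in h3
    by (field; lra).
  assert (0 <= Rabs M * t) by (apply Rmult_le_pos; lra).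
  nra.
Qed.

(** Monotone convergence along a filter: the limit is the supremum over [D].
    Stated for a filter so that it applies to both ends of the half-line. *)
Lemma monotone_bounded_filterlim (F : (R -> Prop) -> Prop) (D : R -> Prop)
    (I : R -> R) (B : R) :
  Filter F ->
  (exists t, D t) ->
  (forall t, D t -> F (fun u => I t <= I u)) ->
  F D ->
  (forall t, D t -> I t <= B) ->
  exists l, filterlim I F (locally l) /\ l <= B /\ forall t, D t -> I t <= l.
Proof.
  intros HF [t0 ht0] hmono hD hB.
  destruct (completeness (fun y => exists t, D t /\ y = I t)) as [l [hub hlub]].
  - exists B. intros y [t [ht ->]]. auto.
  - exists (I t0), t0. auto.
  - exists l. split; [| split].
    + apply filterlim_locally. intros eps.
      assert (exists t, D t /\ l - eps < I t) as [t [ht hlt]].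
      { apply Classical_Prop.NNPP. intros hno.
        assert (l <= l - eps).
        { apply hlub. intros y [t [ht ->]].
          apply Rnot_lt_le. intros h. apply hno. exists t. auto. }
        assert (h := cond_pos eps). lra. }
      generalize (filter_and _ _ (hmono t ht) hD).
      apply filter_imp. intros u [hu hDu].
      assert (I u <= l) by (apply hub; exists u; auto).
      assert (h := cond_pos eps).
      apply Rabs_def1; unfold minus, plus, opp; simpl; lra.
    + apply hlub. intros y [t [ht ->]]. auto.
    + intros t ht. apply hub. exists t. auto.
Qed.

Lemma ex_RInt_continuous_pos (phi : R -> R) (a b : R) :
  (forall u, 0 < u -> continuous phi u) -> 0 < a -> 0 < b -> ex_RInt phi a b.
Proof.
  intros hc ha hb. apply (ex_RInt_continuous phi). intros z hz. apply hc.
  assert (0 < Rmin a b) by (apply Rmin_pos; trivial). lra.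
Qed.

Lemma RInt_nonneg_monotone (phi : R -> R) (a a' b' b : R) :
  (forall u, 0 < u -> continuous phi u) ->
  (forall u, 0 < u -> 0 <= phi u) ->
  0 < a -> a <= a' -> a' <= b' -> b' <= b -> RInt phi a' b' <= RInt phi a b.
Proof.
  intros hc hp h0 h1 h2 h3.
  assert (hex := fun u v hu hv => ex_RInt_continuous_pos phi u v hc hu hv).
  rewrite <- (RInt_Chasles phi a a' b) by (apply hex; lra).
  rewrite <- (RInt_Chasles phi a' b' b) by (apply hex; lra).
  assert (0 <= RInt phi a a')
    by (apply RInt_ge_0; [lra | apply hex; lra | intros; apply hp; lra]).
  assert (0 <= RInt phi b' b)
    by (apply RInt_ge_0; [lra | apply hex; lra | intros; apply hp; lra]).
  unfold plus; simpl. lra.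
Qed.

Lemma is_RInt_gen_at_right_of_bounded (phi : R -> R) (x B : R) :
  0 < x ->
  (forall u, 0 < u -> continuous phi u) ->
  (forall u, 0 < u -> 0 <= phi u) ->
  (forall e, 0 < e < x -> RInt phi e x <= B) ->
  exists l, is_RInt_gen phi (at_right 0) (at_point x) l /\ l <= B /\ 0 <= l.
Proof.
  intros hx hc hp hB.
  assert (hD : at_right 0 (fun e => 0 < e < x)).
  { exists (mkposreal x hx). intros y hy hy0.
    apply Rabs_def2 in hy. unfold minus, plus, opp in hy; simpl in hy. lra. }
  destruct (monotone_bounded_filterlim (at_right 0) (fun e => 0 < e < x)
    (fun e => RInt phi e x) B) as [l [hl [hlB hsup]]]; trivial.
  - typeclasses eauto.
  - exists (x / 2). lra.
  - intros t ht. exists (mkposreal t (proj1 ht)). intros y hy hy0.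
    apply Rabs_def2 in hy. unfold minus, plus, opp in hy; simpl in hy.
    apply RInt_nonneg_monotone; trivial; lra.
  - exists l. split; [| split; trivial].
    + intros P hP. unfold filtermapi.
      apply (Filter_prod _ _ _ (fun e => 0 < e < x /\ P (RInt phi e x)) (fun y => y = x)).
      * apply filter_and; [exact hD | exact (hl P hP)].
      * reflexivity.
      * intros e y [he hPe] ->. exists (RInt phi e x). split; trivial.
        apply (RInt_correct phi), ex_RInt_continuous_pos; trivial; lra.
    + eapply Rle_trans; [| apply (hsup (x / 2)); lra].
      apply RInt_ge_0; [lra | apply ex_RInt_continuous_pos; trivial; lra |].
      intros; apply hp; lra.
Qed.

Lemma is_RInt_gen_p_infty_of_bounded (phi : R -> R) (x B : R) :
  0 < x ->
  (forall u, 0 < u -> continuous phi u) ->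
  (forall u, 0 < u -> 0 < phi u) ->
  (forall T, x < T -> RInt phi x T <= B) ->
  exists l, is_RInt_gen phi (at_point x) (Rbar_locally p_infty) l /\ 0 < l.
Proof.
  intros hx hc hp hB.
  assert (hp' : forall u, 0 < u -> 0 <= phi u) by (intros; left; auto).
  assert (hD : Rbar_locally p_infty (fun T => x < T)) by (exists x; auto).
  destruct (monotone_bounded_filterlim (Rbar_locally p_infty) (fun T => x < T)
    (fun T => RInt phi x T) B) as [l [hl [hlB hsup]]]; trivial.
  - typeclasses eauto.
  - exists (x + 1). lra.
  - intros t ht. exists t. intros y hy.
    apply RInt_nonneg_monotone; trivial; lra.
  - exists l. split.
    + intros P hP. unfold filtermapi.
      apply (Filter_prod _ _ _ (fun y => y = x) (fun T => x < T /\ P (RInt phi x T))).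
      * reflexivity.
      * apply filter_and; [exact hD | exact (hl P hP)].
      * intros y T -> [hT hPT]. exists (RInt phi x T). split; trivial.
        apply (RInt_correct phi), ex_RInt_continuous_pos; trivial; lra.
    + eapply Rlt_le_trans; [| apply (hsup (x + 1)); lra].
      apply RInt_gt_0; [lra | intros; apply hp; lra | intros; apply hc; lra].
Qed.

(** The comparison goes through [U - RInt phi], so [dU] need not be
    continuous. *)
Lemma RInt_le_of_derive (phi U dU : R -> R) (a b : R) :
  0 < a -> a <= b ->
  (forall u, 0 < u -> continuous phi u) ->
  (forall u, 0 < u -> is_derive U u (dU u)) ->
  (forall u, a <= u -> phi u <= dU u) ->
  RInt phi a b <= U b - U a.
Proof.
  intros ha hab hc hU hle.
  assert (h := le_of_derive_nonneg (fun u => U u - RInt phi a u)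
    (fun u => dU u - phi u) a b ha hab).
  simpl in h. rewrite RInt_point in h. unfold zero in h; simpl in h.
  cut (U a - 0 <= U b - RInt phi a b); [lra |].
  apply h.
  - intros u hu. apply (is_derive_minus U (fun u => RInt phi a u)); [auto |].
    apply (is_derive_RInt phi (fun u => RInt phi a u) a u); [| auto].
    exists (mkposreal u hu). intros y hy.
    apply Rabs_def2 in hy. unfold minus, plus, opp in hy; simpl in hy.
    apply (RInt_correct phi), ex_RInt_continuous_pos; trivial; lra.
  - intros u hu. specialize (hle u hu). lra.
Qed.

(** * The Gamma function on the positive half-line *)

Definition gamma_integrand (s t : R) : R := Rpower t (s - 1) * exp (- t).

Lemma gamma_integrand_pos (s t : R) : 0 < gamma_integrand s t.
Proof. apply Rmult_lt_0_compat; apply exp_pos. Qed.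

Lemma continuous_gamma_integrand (s t : R) : 0 < t -> continuous (gamma_integrand s) t.
Proof.
  intros ht. apply (ex_derive_continuous (gamma_integrand s)).
  apply (ex_derive_mult (fun u => Rpower u (s - 1)) (fun u => exp (- u))).
  - eexists. apply is_derive_Rpower, ht.
  - auto_derive. trivial.
Qed.

(** From [ln u <= u - 1] at [u = t / (2 k)], with [k > |c|]. *)
Lemma Rpower_le_exp_half (c : R) :
  exists M, 0 < M /\ forall t, 1 <= t -> Rpower t c <= M * exp (t / 2).
Proof.
  set (k := Rabs c + 1).
  assert (hk : 0 < k) by (unfold k; assert (h := Rabs_pos c); lra).
  exists (exp (k * ln (2 * k))). split; [apply exp_pos |].
  intros t ht. rewrite <- exp_plus. unfold Rpower.
  assert (hln0 : 0 <= ln t) by (rewrite <- ln_1; apply ln_le; lra).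
  assert (hln : ln t <= t / (2 * k) + ln (2 * k)).
  { replace (ln t) with (ln (t / (2 * k)) + ln (2 * k)).
    - assert (hp : 0 < t / (2 * k)) by (apply Rdiv_lt_0_compat; lra).
      assert (h := exp_ineq1_le (ln (t / (2 * k)))).
      rewrite exp_ln in h by trivial. lra.
    - rewrite <- ln_mult; [f_equal; field; lra | apply Rdiv_lt_0_compat; lra | lra]. }
  assert (hc : c * ln t <= k * ln t).
  { apply Rmult_le_compat_r; trivial. unfold k. assert (h := Rle_abs c). lra. }
  assert (hk2 : k * ln t <= k * (t / (2 * k) + ln (2 * k)))
    by (apply Rmult_le_compat_l; lra).
  replace (k * (t / (2 * k) + ln (2 * k))) with (k * ln (2 * k) + t / 2) in hk2
    by (field; lra).
  assert (hle : c * ln t <= k * ln (2 * k) + t / 2) by lra.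
  destruct hle as [hlt | ->]; [left; apply exp_increasing, hlt | right; reflexivity].
Qed.

(** Near 0 the integrand is at most [t^(s-1)], near infinity at most a multiple
    of [exp (- t / 2)]; both have explicit primitives. *)
Lemma is_RInt_gen_EulerGamma (s : R) : 0 < s ->
  is_RInt_gen (gamma_integrand s) (at_right 0) (Rbar_locally p_infty) (EulerGamma s)
  /\ 0 < EulerGamma s.
Proof.
  intros hs.
  assert (hc := continuous_gamma_integrand s).
  destruct (is_RInt_gen_at_right_of_bounded (gamma_integrand s) 1 (1 / s))
    as [l1 [hl1 [_ hl1']]]; trivial; try lra.
  - intros u _. left. apply gamma_integrand_pos.
  - intros e he.
    assert (h := RInt_le_of_derive (gamma_integrand s) (fun t => Rpower t s / s)
      (fun t => Rpower t (s - 1)) e 1 (proj1 he) (Rlt_le _ _ (proj2 he)) hc).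
    assert (h1 : Rpower 1 s = 1)
      by (unfold Rpower; rewrite ln_1, Rmult_0_r, exp_0; reflexivity).
    assert (h0 : 0 < Rpower e s / s)
      by (apply Rdiv_lt_0_compat; [apply Rpower_pos | trivial]).
    simpl in h. rewrite h1 in h.
    cut (RInt (gamma_integrand s) e 1 <= 1 / s - Rpower e s / s); [lra |].
    apply h.
    + intros u hu.
      replace (Rpower u (s - 1)) with (/ s * (s / u * Rpower u s))
        by (rewrite Rpower_minus_1 by trivial; field; lra).
      apply (is_derive_ext (fun t => / s * Rpower t s)).
      * intros t. apply Rmult_comm.
      * apply (is_derive_scal (fun t => Rpower t s)), is_derive_Rpower, hu.
    + intros u hu. unfold gamma_integrand.
      rewrite <- (Rmult_1_r (Rpower u (s - 1))) at 2.
      apply Rmult_le_compat_l; [left; apply Rpower_pos |].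
      rewrite <- exp_0. left. apply exp_increasing. lra.
  - destruct (Rpower_le_exp_half (s - 1)) as [M [hM hle]].
    destruct (is_RInt_gen_p_infty_of_bounded (gamma_integrand s) 1 (2 * M))
      as [l2 [hl2 hl2']]; trivial; try lra.
    + intros u _. apply gamma_integrand_pos.
    + intros T hT.
      assert (h := RInt_le_of_derive (gamma_integrand s) (fun t => - 2 * M * exp (- t / 2))
        (fun t => M * exp (- t / 2)) 1 T Rlt_0_1 (Rlt_le _ _ hT) hc).
      assert (hT0 : 0 < M * exp (- T / 2)) by (apply Rmult_lt_0_compat; [trivial | apply exp_pos]).
      assert (h1 : exp (- 1 / 2) <= 1)
        by (rewrite <- exp_0; left; apply exp_increasing; lra).
      assert (M * exp (- 1 / 2) <= M * 1) by (apply Rmult_le_compat_l; lra).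
      cut (RInt (gamma_integrand s) 1 T <= - 2 * M * exp (- T / 2) - - 2 * M * exp (- 1 / 2)); [lra |].
      apply h.
      * intros u _. auto_derive; trivial. unfold Rdiv. field.
      * intros u hu. unfold gamma_integrand.
        replace (exp (- u / 2)) with (exp (u / 2) * exp (- u))
          by (rewrite <- exp_plus; f_equal; field).
        rewrite <- Rmult_assoc. apply Rmult_le_compat_r; [left; apply exp_pos | auto].
    + assert (hg := is_RInt_gen_Chasles _ _ _ _ hl1 hl2).
      assert (he : EulerGamma s = l1 + l2) by exact (is_RInt_gen_unique _ _ hg).
      rewrite he. split; [exact hg | lra].
Qed.

Lemma EulerGamma_pos (s : R) : 0 < s -> 0 < EulerGamma s.
Proof. intros hs. apply is_RInt_gen_EulerGamma, hs. Qed.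

Lemma gamma_primitive_at_right (s : R) : 0 < s ->
  filterlim (fun t => Rpower t s * exp (- t)) (at_right 0) (locally 0).
Proof.
  intros hs. apply filterlim_locally. intros eps.
  exists (mkposreal (Rpower eps (/ s)) (Rpower_pos _ _)).
  intros t ht ht0. apply Rabs_def2 in ht. unfold minus, plus, opp in ht; simpl in ht.
  assert (h1 : Rpower t s < eps).
  { replace (pos eps) with (Rpower (Rpower eps (/ s)) s).
    - apply Rlt_Rpower_l; lra.
    - rewrite Rpower_mult, Rinv_l, Rpower_1; try lra. apply cond_pos. }
  assert (h2 : exp (- t) < 1) by (rewrite <- exp_0; apply exp_increasing; lra).
  assert (h3 := exp_pos (- t)). assert (h4 := Rpower_pos t s).
  apply Rabs_def1; unfold minus, plus, opp; simpl; nra.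
Qed.

Lemma gamma_primitive_p_infty (s : R) :
  filterlim (fun t => Rpower t s * exp (- t)) (Rbar_locally p_infty) (locally 0).
Proof.
  apply filterlim_locally. intros eps.
  destruct (Rpower_le_exp_half s) as [M [hM hle]].
  assert (heps := cond_pos eps).
  exists (Rmax 1 (2 * M / eps)). intros t ht.
  assert (ht1 := Rle_lt_trans _ _ _ (Rmax_l _ _) ht).
  assert (ht2 := Rle_lt_trans _ _ _ (Rmax_r _ _) ht).
  assert (h : Rpower t s * exp (- t) <= M * exp (- (t / 2))).
  { replace (exp (- (t / 2))) with (exp (t / 2) * exp (- t))
      by (rewrite <- exp_plus; f_equal; field).
    rewrite <- Rmult_assoc. apply Rmult_le_compat_r; [left; apply exp_pos | apply hle; lra]. }
  assert (h2 : M * exp (- (t / 2)) < eps).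
  { rewrite exp_Ropp. apply Rmult_lt_reg_r with (exp (t / 2)); [apply exp_pos |].
    rewrite Rmult_assoc, Rinv_l, Rmult_1_r by (apply Rgt_not_eq, exp_pos).
    assert (h3 := exp_ineq1_le (t / 2)).
    apply Rlt_le_trans with (eps * (t / 2)); [| apply Rmult_le_compat_l; lra].
    apply (Rmult_lt_compat_l (eps / 2)) in ht2; [| lra].
    replace (eps / 2 * (2 * M / eps)) with M in ht2 by (field; lra). lra. }
  assert (h3 : 0 < Rpower t s * exp (- t))
    by (apply Rmult_lt_0_compat; apply exp_pos).
  apply Rabs_def1; unfold minus, plus, opp; simpl; lra.
Qed.

(** Integration by parts: [t^s exp (- t)] vanishes at both ends, and its
    derivative is [s] times the integrand at [s] minus the integrand at
    [s + 1]. *)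
Lemma EulerGamma_succ (s : R) : 0 < s -> EulerGamma (s + 1) = s * EulerGamma s.
Proof.
  intros hs.
  destruct (is_RInt_gen_EulerGamma s hs) as [h1 _].
  destruct (is_RInt_gen_EulerGamma (s + 1)) as [h2 _]; [lra |].
  assert (hd : forall t, 0 < t -> is_derive (fun t => Rpower t s * exp (- t)) t
    (s * gamma_integrand s t - gamma_integrand (s + 1) t)).
  { intros t ht. assert (hw := is_derive_weighted (-1) s (fun _ => 1) t 0 ht (is_derive_const 1 t)).
    apply (is_derive_ext (fun u => exp (-1 * u) * Rpower u s * 1)).
    - intros u. replace (-1 * u) with (- u) by ring.
      rewrite Rmult_1_r. apply Rmult_comm.
    - replace (s * gamma_integrand s t - gamma_integrand (s + 1) t)
        with (exp (-1 * t) * Rpower t s * (0 + (-1 + s / t) * 1)); [exact hw |].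
      unfold gamma_integrand. replace (s + 1 - 1) with s by ring.
      rewrite Rpower_minus_1 by trivial.
      replace (-1 * t) with (- t) by ring. field. lra. }
  assert (hpos : filter_prod (at_right 0) (Rbar_locally p_infty) (fun ab : R * R =>
    forall x, Rmin (fst ab) (snd ab) <= x <= Rmax (fst ab) (snd ab) -> 0 < x)).
  { apply (Filter_prod _ _ _ (fun a => 0 < a) (fun b => 0 < b)).
    - exists (mkposreal 1 Rlt_0_1). auto.
    - exists 0. auto.
    - intros a b ha hb x [hx _]. simpl in hx.
      assert (0 < Rmin a b) by (apply Rmin_pos; trivial). lra. }
  assert (hD : forall t, 0 < t -> Derive (fun t => Rpower t s * exp (- t)) t =
    s * gamma_integrand s t - gamma_integrand (s + 1) t)
    by (intros t ht; apply is_derive_unique, hd, ht).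
  assert (hz : is_RInt_gen (Derive (fun t => Rpower t s * exp (- t)))
    (at_right 0) (Rbar_locally p_infty) (0 - 0)).
  { apply is_RInt_gen_Derive.
    - revert hpos. apply filter_imp. intros ab h x hx. eexists. apply hd. auto.
    - revert hpos. apply filter_imp. intros ab h x hx. specialize (h x hx).
      apply (continuous_ext_loc _ (fun t => s * gamma_integrand s t - gamma_integrand (s + 1) t)).
      + exists (mkposreal x h). intros y hy.
        apply Rabs_def2 in hy. unfold minus, plus, opp in hy; simpl in hy.
        symmetry. apply hD. lra.
      + apply (continuous_minus (fun t => s * gamma_integrand s t) (gamma_integrand (s + 1))).
        * apply (continuous_scal_r s (gamma_integrand s)), continuous_gamma_integrand, h.
        * apply continuous_gamma_integrand, h.
    - apply gamma_primitive_at_right, hs.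
    - apply gamma_primitive_p_infty. }
  assert (hm := is_RInt_gen_minus _ _ _ _ (is_RInt_gen_scal _ s _ h1) h2).
  apply (is_RInt_gen_ext _ (fun t => minus (scal s (gamma_integrand s t)) (gamma_integrand (s + 1) t))) in hz.
  - assert (e1 := eq_trans (eq_sym (is_RInt_gen_unique _ _ hm)) (is_RInt_gen_unique _ _ hz)).
    unfold minus, plus, opp, scal in e1; simpl in e1. unfold mult in e1; simpl in e1. lra.
  - revert hpos. apply filter_imp. intros ab h x hx. rewrite hD; [reflexivity |].
    apply h. lra.
Qed.

(** For [s > 0] no shift occurs in [rGamma], because [up (- s) <= 0]. *)
Lemma rGamma_eq (s : R) : 0 < s -> rGamma s = / EulerGamma s.
Proof.
  intros hs. unfold rGamma.
  replace (Z.to_nat (up (- s))) with 0%nat.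
  - simpl. rewrite Rplus_0_r. unfold Rdiv. ring.
  - destruct (archimed (- s)) as [_ h].
    assert (hz : (up (- s) < 1)%Z) by (apply lt_IZR; lra).
    destruct (up (- s)); simpl; lia.
Qed.

Lemma rGamma_pos (s : R) : 0 < s -> 0 < rGamma s.
Proof.
  intros hs. rewrite rGamma_eq by trivial. apply Rinv_0_lt_compat, EulerGamma_pos, hs.
Qed.

Lemma rGamma_succ (s : R) : 0 < s -> s * rGamma (s + 1) = rGamma s.
Proof.
  intros hs. rewrite !rGamma_eq by lra. rewrite EulerGamma_succ by trivial.
  field. split; [apply Rgt_not_eq, EulerGamma_pos; trivial | lra].
Qed.

(** * Power series of the Lommel functions *)

Lemma ex_pseries_entire (c : nat -> R) (z : R) :
  CV_radius c = p_infty -> ex_pseries c z.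
Proof. intros hc. apply CV_radius_inside. rewrite hc. exact I. Qed.

Lemma PSeries_nonneg (c : nat -> R) (z : R) :
  (forall k, 0 <= c k) -> CV_radius c = p_infty -> 0 <= z -> 0 <= PSeries c z.
Proof.
  intros hc hcv hz. rewrite <- (PSeries_const_0 z).
  apply Series_le.
  - intros k. rewrite Rmult_0_l. split; [lra |].
    apply Rmult_le_pos; [auto | apply pow_le; trivial].
  - apply ex_pseries_R, ex_pseries_entire, hcv.
Qed.

Lemma PSeries_le_of_le (c : nat -> R) (z z' : R) :
  (forall k, 0 <= c k) -> CV_radius c = p_infty -> 0 <= z <= z' ->
  PSeries c z <= PSeries c z'.
Proof.
  intros hc hcv hz. apply Series_le.
  - intros k. split.
    + apply Rmult_le_pos; [auto | apply pow_le; lra].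
    + apply Rmult_le_compat_l; [auto | apply pow_incr; lra].
  - apply ex_pseries_R, ex_pseries_entire, hcv.
Qed.

Definition lommel_coeff (a b : R) (k : nat) : R :=
  rGamma (INR k + a) * rGamma (INR k + b).

Lemma lommel_coeff_pos (a b : R) (k : nat) : 0 < a -> 0 < b -> 0 < lommel_coeff a b k.
Proof.
  intros ha hb. assert (hk := pos_INR k).
  apply Rmult_lt_0_compat; apply rGamma_pos; lra.
Qed.

(** This and the next relation are the two functional equations behind the
    differential system: one lowers the second Gamma factor, the other steps
    along the series with the first. *)
Lemma lommel_coeff_shift (a b : R) (k : nat) : 0 < b ->
  (INR k + b) * lommel_coeff a (b + 1) k = lommel_coeff a b k.
Proof.
  intros hb. assert (hk := pos_INR k). unfold lommel_coeff.
  rewrite <- (rGamma_succ (INR k + b)) by lra.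
  replace (INR k + (b + 1)) with (INR k + b + 1) by ring. ring.
Qed.

Lemma lommel_coeff_succ (a b : R) (k : nat) : 0 < a ->
  (INR k + a) * lommel_coeff a b (S k) = lommel_coeff a (b + 1) k.
Proof.
  intros ha. assert (hk := pos_INR k). unfold lommel_coeff. rewrite S_INR.
  rewrite <- (rGamma_succ (INR k + a)) by lra.
  replace (INR k + (b + 1)) with (INR k + 1 + b) by ring.
  replace (INR k + a + 1) with (INR k + 1 + a) by ring. ring.
Qed.

Lemma CV_radius_lommel_coeff (a b : R) : 0 < a -> 0 < b ->
  CV_radius (lommel_coeff a b) = p_infty.
Proof.
  intros ha hb. apply CV_radius_infinite_DAlembert.
  - intros k. apply Rgt_not_eq, lommel_coeff_pos; trivial.
  - apply (is_lim_seq_le_le (fun _ => 0) _ (fun k => / b * / (INR k + a))).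
    + intros k. assert (hk := pos_INR k).
      assert (hp := lommel_coeff_pos a (b + 1) k ha ltac:(lra)).
      assert (hq := lommel_coeff_succ a b k ha).
      assert (hr := lommel_coeff_shift a b k hb).
      assert (hS := lommel_coeff_pos a b (S k) ha hb).
      assert (h0 := lommel_coeff_pos a b k ha hb).
      rewrite Rabs_pos_eq by (left; apply Rdiv_lt_0_compat; trivial).
      split; [left; apply Rdiv_lt_0_compat; trivial |].
      rewrite <- hr, <- hq.
      replace (lommel_coeff a b (S k) / ((INR k + b) * ((INR k + a) * lommel_coeff a b (S k))))
        with (/ (INR k + b) * / (INR k + a)) by (field; repeat split; lra).
      apply Rmult_le_compat_r; [left; apply Rinv_0_lt_compat; lra |].
      apply Rinv_le_contravar; lra.
    + apply is_lim_seq_const.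
    + replace (Finite 0) with (Rbar_mult (/ b) 0) by (simpl; f_equal; ring).
      apply is_lim_seq_scal_l.
      apply (is_lim_seq_inv (fun k => INR k + a) p_infty); [| discriminate].
      apply (is_lim_seq_plus INR (fun _ => a) p_infty a);
        [apply is_lim_seq_INR | apply is_lim_seq_const | reflexivity].
Qed.

(** Power-series form of [g' = f - ((nu + 1) / x) g]. *)
Lemma lommel_series_shift (a b z : R) : 0 < a -> 0 < b ->
  PSeries (lommel_coeff a b) z =
  b * PSeries (lommel_coeff a (b + 1)) z
  + z * PSeries (PS_derive (lommel_coeff a (b + 1))) z.
Proof.
  intros ha hb.
  assert (hcv := CV_radius_lommel_coeff a (b + 1) ha ltac:(lra)).
  rewrite <- PSeries_scal, <- PSeries_incr_1, <- PSeries_plus.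
  - apply PSeries_ext. intros k.
    rewrite <- lommel_coeff_shift by trivial.
    destruct k as [| k].
    + change ((INR 0 + b) * lommel_coeff a (b + 1) 0
        = b * lommel_coeff a (b + 1) 0 + 0).
      simpl INR. ring.
    + change ((INR (S k) + b) * lommel_coeff a (b + 1) (S k)
        = b * lommel_coeff a (b + 1) (S k) + INR (S k) * lommel_coeff a (b + 1) (S k)).
      ring.
  - apply ex_pseries_scal; [apply Rmult_comm | apply ex_pseries_entire, hcv].
  - apply ex_pseries_incr_1. apply ex_pseries_entire. rewrite CV_radius_derive. exact hcv.
Qed.

(** Power-series form of [f' = (nu / x) f + g + p]; the constant coefficient,
    which is not reached by the recursion, becomes the source term [p]. *)
Lemma lommel_series_derive (a b z : R) : 0 < a -> 0 < b ->
  z * PSeries (PS_derive (lommel_coeff a b)) z =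
  z * PSeries (lommel_coeff a (b + 1)) z
  - (a - 1) * (PSeries (lommel_coeff a b) z - lommel_coeff a b 0).
Proof.
  intros ha hb.
  assert (hcv := CV_radius_lommel_coeff a b ha hb).
  rewrite (PSeries_decr_1 (lommel_coeff a b)) by (apply ex_pseries_entire, hcv).
  assert (h : PSeries (lommel_coeff a (b + 1)) z =
    PSeries (PS_derive (lommel_coeff a b)) z
    + (a - 1) * PSeries (PS_decr_1 (lommel_coeff a b)) z).
  { rewrite <- PSeries_scal, <- PSeries_plus.
    - apply PSeries_ext. intros k.
      rewrite <- lommel_coeff_succ by trivial.
      change ((INR k + a) * lommel_coeff a b (S k)
        = INR (S k) * lommel_coeff a b (S k) + (a - 1) * lommel_coeff a b (S k)).
      rewrite S_INR. ring.
    - apply ex_pseries_entire. rewrite CV_radius_derive. exact hcv.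
    - apply ex_pseries_scal; [apply Rmult_comm |].
      apply ex_pseries_entire. rewrite CV_radius_decr_1. exact hcv. }
  rewrite h. ring.
Qed.

Definition half_power_series (e : R) (c : nat -> R) (x : R) : R :=
  Rpower (x / 2) e * PSeries c ((x / 2) ^ 2).

Lemma lommel_t_eq (mu nu x : R) : 0 < x ->
  lommel_t mu nu x =
  half_power_series (mu + 1) (lommel_coeff ((mu - nu + 3) / 2) ((mu + nu + 3) / 2)) x.
Proof.
  intros hx. unfold lommel_t, half_power_series, PSeries.
  rewrite <- Series_scal_l. apply Series_ext. intros k.
  replace (mu + 2 * INR k + 1) with (mu + 1 + INR (2 * k))
    by (rewrite mult_INR; simpl; ring).
  rewrite Rpower_plus, Rpower_pow by lra. rewrite pow_mult.
  unfold lommel_coeff. ring.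
Qed.

Lemma lommel_t_succ_eq (mu nu x : R) : 0 < x ->
  lommel_t (mu + 1) (nu + 1) x =
  half_power_series (mu + 2)
    (lommel_coeff ((mu - nu + 3) / 2) ((mu + nu + 3) / 2 + 1)) x.
Proof.
  intros hx. rewrite lommel_t_eq by trivial.
  replace (mu + 1 + 1) with (mu + 2) by ring.
  replace ((mu + 1 - (nu + 1) + 3) / 2) with ((mu - nu + 3) / 2) by field.
  replace ((mu + 1 + (nu + 1) + 3) / 2) with ((mu + nu + 3) / 2 + 1) by field.
  reflexivity.
Qed.

Lemma is_derive_half_power_series (e : R) (c : nat -> R) (x : R) :
  CV_radius c = p_infty -> 0 < x ->
  is_derive (half_power_series e c) x
    (e / x * half_power_series e c x
     + Rpower (x / 2) e * (x / 2 * PSeries (PS_derive c) ((x / 2) ^ 2))).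
Proof.
  intros hcv hx. unfold half_power_series.
  assert (h1 : is_derive (fun u => Rpower (u / 2) e) x (e / x * Rpower (x / 2) e)).
  { replace (e / x * Rpower (x / 2) e)
      with (/ 2 * (e / (x / 2) * Rpower (x / 2) e)) by (field; lra).
    apply (is_derive_comp (fun v => Rpower v e) (fun u => u / 2)).
    - apply is_derive_Rpower. lra.
    - auto_derive; trivial. field. }
  assert (h2 : is_derive (fun u => PSeries c ((u / 2) ^ 2)) x
    (x / 2 * PSeries (PS_derive c) ((x / 2) ^ 2))).
  { apply (is_derive_comp (PSeries c) (fun u => (u / 2) ^ 2)).
    - apply is_derive_PSeries. rewrite hcv. exact I.
    - auto_derive; trivial. field. }
  replace (e / x * (Rpower (x / 2) e * PSeries c ((x / 2) ^ 2)))
    with ((e / x * Rpower (x / 2) e) * PSeries c ((x / 2) ^ 2)) by ring.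
  apply (is_derive_mult _ _ _ _ _ h1 h2). intros; apply Rmult_comm.
Qed.

Lemma half_power_series_near_0 (e : R) (c : nat -> R) :
  (forall k, 0 < c k) -> CV_radius c = p_infty ->
  exists M, 0 < M /\ forall x, 0 < x <= 1 -> half_power_series e c x <= M * Rpower x e.
Proof.
  intros hc hcv.
  assert (hc' : forall k, 0 <= c k) by (intros; left; auto).
  assert (h1 : 0 < PSeries c 1).
  { apply Rlt_le_trans with (PSeries c 0).
    - rewrite PSeries_0. auto.
    - apply PSeries_le_of_le; trivial. lra. }
  exists (Rpower (/ 2) e * PSeries c 1). split.
  - apply Rmult_lt_0_compat; [apply Rpower_pos | trivial].
  - intros x hx. unfold half_power_series, Rdiv.
    rewrite <- Rpower_mult_distr by lra.
    replace (Rpower (/ 2) e * PSeries c 1 * Rpower x e)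
      with (Rpower x e * Rpower (/ 2) e * PSeries c 1) by ring.
    apply Rmult_le_compat_l.
    + left. apply Rmult_lt_0_compat; apply Rpower_pos.
    + apply PSeries_le_of_le; trivial. split; [apply pow2_ge_0 |]. nra.
Qed.

Lemma half_power_series_ge_head (e : R) (c : nat -> R) (x : R) :
  (forall k, 0 < c k) -> CV_radius c = p_infty ->
  Rpower (x / 2) e * c 0%nat <= half_power_series e c x.
Proof.
  intros hc hcv. apply Rmult_le_compat_l; [left; apply Rpower_pos |].
  rewrite <- (PSeries_0 c) at 1.
  apply PSeries_le_of_le; trivial.
  - intros; left; auto.
  - split; [lra | apply pow2_ge_0].
Qed.

Lemma half_power_series_pos (e : R) (c : nat -> R) (x : R) :
  (forall k, 0 < c k) -> CV_radius c = p_infty -> 0 < half_power_series e c x.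
Proof.
  intros hc hcv.
  apply Rlt_le_trans with (Rpower (x / 2) e * c 0%nat);
    [apply Rmult_lt_0_compat; [apply Rpower_pos | auto] |].
  apply half_power_series_ge_head; trivial.
Qed.

(** Everything about the pair [t_{mu,nu}], [t_{mu+1,nu+1}] that the integral
    bound depends on.  The bound [system_p_le] compares the source with the first
    term of the series of [g], with which it agrees exactly. *)
Record lommel_system (mu nu : R) (f g p : R -> R) : Prop := {
  system_derive_f : forall x, 0 < x -> is_derive f x (nu / x * f x + g x + p x);
  system_derive_g : forall x, 0 < x -> is_derive g x (f x - (nu + 1) / x * g x);
  system_f_pos : forall x, 0 < x -> 0 < f x;
  system_g_pos : forall x, 0 < x -> 0 < g x;
  system_p_nonneg : forall x, 0 < x -> 0 <= p x;
  system_p_le : forall x, 0 < x ->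
    x ^ 2 * p x <= (mu + nu + 3) * (mu - nu + 1) * g x;
  system_ratio : forall x, 0 < x -> (mu + nu + 3) * g x <= x * f x;
  system_near_0 : exists M, 0 < M /\ forall x, 0 < x <= 1 ->
    f x <= M * Rpower x (mu + 1) /\ g x <= M * Rpower x (mu + 2)
}.

(** The fields [system_p_le] and [system_ratio] are read off the series: [g] is at
    least its first term, and [x f - (mu + nu + 3) g] is a positive multiple of
    the derivative of the power series of [g]. *)
Lemma lommel_t_system (mu nu : R) :
  - (3 / 2) < mu -> - (1 / 2) < nu -> nu < mu + 1 ->
  lommel_system mu nu (lommel_t mu nu) (lommel_t (mu + 1) (nu + 1))
    (fun x => Rpower (x / 2) mu * ((mu - nu + 1) / 2
       * lommel_coeff ((mu - nu + 3) / 2) ((mu + nu + 3) / 2) 0)).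
Proof.
  intros h0 h1 h2.
  set (a := (mu - nu + 3) / 2). set (b := (mu + nu + 3) / 2).
  assert (ha : 1 < a) by (unfold a; lra). assert (hb : 0 < b) by (unfold b; lra).
  set (al := lommel_coeff a b). set (ga := lommel_coeff a (b + 1)).
  assert (hal : forall k, 0 < al k) by (intros; apply lommel_coeff_pos; lra).
  assert (hga : forall k, 0 < ga k) by (intros; apply lommel_coeff_pos; lra).
  assert (hcal : CV_radius al = p_infty) by (apply CV_radius_lommel_coeff; lra).
  assert (hcga : CV_radius ga = p_infty) by (apply CV_radius_lommel_coeff; lra).
  assert (ef : forall x, 0 < x -> lommel_t mu nu x = half_power_series (mu + 1) al x)
    by (intros; apply lommel_t_eq; trivial).
  assert (eg : forall x, 0 < x ->
    lommel_t (mu + 1) (nu + 1) x = half_power_series (mu + 2) ga x)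
    by (intros; apply lommel_t_succ_eq; trivial).
  assert (hnear : forall x, 0 < x -> locally x (fun y => 0 < y)).
  { intros x hx. exists (mkposreal x hx). intros y hy.
    apply Rabs_def2 in hy. unfold minus, plus, opp in hy; simpl in hy. lra. }
  assert (hpow : forall x, 0 < x ->
    Rpower (x / 2) (mu + 1) = Rpower (x / 2) mu * (x / 2) /\
    Rpower (x / 2) (mu + 2) = Rpower (x / 2) mu * (x / 2) * (x / 2)).
  { intros x hx. replace (mu + 2) with (mu + 1 + 1) by ring.
    rewrite !Rpower_succ by lra. auto. }
  assert (hshift := fun z => lommel_series_shift a b z ltac:(lra) hb).
  assert (hder := fun z => lommel_series_derive a b z ltac:(lra) hb).
  fold al ga in hshift, hder.
  split.
  - intros x hx.
    apply (is_derive_ext_loc (half_power_series (mu + 1) al)).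
    + generalize (hnear x hx). apply filter_imp. intros y hy. symmetry. auto.
    + rewrite ef, eg by trivial.
      match goal with |- is_derive _ _ ?e => replace e with
        ((mu + 1) / x * half_power_series (mu + 1) al x
         + Rpower (x / 2) (mu + 1) * (x / 2 * PSeries (PS_derive al) ((x / 2) ^ 2))) end.
      * apply is_derive_half_power_series; trivial.
      * unfold half_power_series. destruct (hpow x hx) as [-> ->].
        specialize (hder ((x / 2) ^ 2)).
        replace (Rpower (x / 2) mu * (x / 2) * (x / 2 * PSeries (PS_derive al) ((x / 2) ^ 2)))
          with (Rpower (x / 2) mu * ((x / 2) ^ 2 * PSeries (PS_derive al) ((x / 2) ^ 2)))
          by ring.
        rewrite hder. unfold a. field. lra.
  - intros x hx.
    apply (is_derive_ext_loc (half_power_series (mu + 2) ga)).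
    + generalize (hnear x hx). apply filter_imp. intros y hy. symmetry. auto.
    + rewrite ef, eg by trivial.
      match goal with |- is_derive _ _ ?e => replace e with
        ((mu + 2) / x * half_power_series (mu + 2) ga x
         + Rpower (x / 2) (mu + 2) * (x / 2 * PSeries (PS_derive ga) ((x / 2) ^ 2))) end.
      * apply is_derive_half_power_series; trivial.
      * unfold half_power_series. destruct (hpow x hx) as [-> ->].
        rewrite hshift. unfold b. field. lra.
  - intros x hx. rewrite ef by trivial. apply half_power_series_pos; trivial.
  - intros x hx. rewrite eg by trivial. apply half_power_series_pos; trivial.
  - intros x hx. apply Rmult_le_pos; [left; apply Rpower_pos |].
    apply Rmult_le_pos; [lra | left; auto].
  - intros x hx. rewrite eg by trivial.
    assert (hhead := half_power_series_ge_head (mu + 2) ga x hga hcga).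
    assert (e0 := lommel_coeff_shift a b 0 hb). fold al ga in e0.
    rewrite <- e0. destruct (hpow x hx) as [_ e2]. rewrite e2 in hhead.
    apply Rle_trans with ((mu + nu + 3) * (mu - nu + 1)
      * (Rpower (x / 2) mu * (x / 2) * (x / 2) * ga 0%nat)).
    + right. unfold b. simpl. field.
    + apply Rmult_le_compat_l; [apply Rmult_le_pos; lra | exact hhead].
  - intros x hx. rewrite ef, eg by trivial.
    unfold half_power_series. destruct (hpow x hx) as [-> ->].
    rewrite hshift. apply Rminus_le_0.
    match goal with |- 0 <= ?e => replace e with
      (Rpower (x / 2) mu * x ^ 2 / 2
       * ((x / 2) ^ 2 * PSeries (PS_derive ga) ((x / 2) ^ 2))) by (unfold b; field) end.
    apply Rmult_le_pos.
    + assert (0 < Rpower (x / 2) mu * x ^ 2)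
        by (apply Rmult_lt_0_compat; [apply Rpower_pos | apply pow_lt; trivial]). lra.
    + apply Rmult_le_pos; [apply pow2_ge_0 |].
      apply PSeries_nonneg; [| rewrite CV_radius_derive; trivial | apply pow2_ge_0].
      intros k. apply Rmult_le_pos; [apply pos_INR | left; auto].
  - destruct (half_power_series_near_0 (mu + 1) al hal hcal) as [M1 [hM1 hf]].
    destruct (half_power_series_near_0 (mu + 2) ga hga hcga) as [M2 [hM2 hg]].
    exists (M1 + M2). split; [lra |]. intros x hx.
    rewrite ef, eg by lra.
    specialize (hf x hx). specialize (hg x hx).
    assert (0 < M2 * Rpower x (mu + 1)) by (apply Rmult_lt_0_compat; [lra | apply Rpower_pos]).
    assert (0 < M1 * Rpower x (mu + 2)) by (apply Rmult_lt_0_compat; [lra | apply Rpower_pos]).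
    lra.
Qed.

(** * Comparison of the two Lommel functions, and trial functions *)

Lemma exp_le_3_of_le_1 (x : R) : 0 < x <= 1 -> exp (1 * x) <= 3.
Proof.
  intros hx. apply Rle_trans with (exp 1); [| apply exp_le_3].
  destruct (Rle_lt_or_eq_dec (1 * x) 1) as [h | ->]; [lra | | lra].
  left. apply exp_increasing, h.
Qed.

Lemma weighted_lower_bound (c e M : R) (x y : R) :
  0 <= M -> 0 < x <= 1 -> - (M * Rpower x e) <= y ->
  - (3 * M * Rpower x (e + c)) <= exp (1 * x) * Rpower x c * y.
Proof.
  intros hM hx hy. rewrite Rpower_plus.
  assert (h3 := exp_le_3_of_le_1 x hx).
  assert (h0 := exp_pos (1 * x)).
  assert (hc := Rpower_pos x c). assert (he := Rpower_pos x e).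
  set (A := exp (1 * x)) in *. set (P := Rpower x c) in *. set (Q := Rpower x e) in *.
  assert (0 < A * P) by (apply Rmult_lt_0_compat; trivial).
  assert (A * P * - (M * Q) <= A * P * y) by (apply Rmult_le_compat_l; lra).
  assert (0 <= M * Q * P) by (repeat apply Rmult_le_pos; lra).
  nra.
Qed.

(** Comparison principle for [y' + (1 + c/x) y >= 0]: the integrating factor
    [exp x * x^c] makes the left side a derivative, and [e + c > 0] makes the
    lower bound of the weighted function tend to 0 at 0. *)
Lemma nonneg_of_weighted_derive (c e M : R) (y dy : R -> R) :
  0 <= M -> 0 < e + c ->
  (forall x, 0 < x -> is_derive y x (dy x)) ->
  (forall x, 0 < x -> 0 <= dy x + (1 + c / x) * y x) ->
  (forall x, 0 < x <= 1 -> - (M * Rpower x e) <= y x) ->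
  forall x, 0 < x -> 0 <= y x.
Proof.
  intros hM hec hy hdy hlow x hx.
  assert (h := nonneg_of_derive_nonneg (fun u => exp (1 * u) * Rpower u c * y u)
    (fun u => exp (1 * u) * Rpower u c * (dy u + (1 + c / u) * y u))
    (3 * M) (e + c) hec).
  simpl in h. apply Rmult_le_reg_l with (exp (1 * x) * Rpower x c).
  - apply Rmult_lt_0_compat; apply exp_pos.
  - rewrite Rmult_0_r. apply h; trivial.
    + intros u hu. apply is_derive_weighted; auto.
    + intros u hu. apply Rmult_le_pos; [| auto].
      left. apply Rmult_lt_0_compat; apply exp_pos.
    + intros u hu. apply weighted_lower_bound; auto.
Qed.

Lemma is_derive_difference (mu nu : R) (f g p : R -> R) (x : R) :
  lommel_system mu nu f g p -> 0 < x ->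
  is_derive (fun u => f u - g u) x
    (- (f x - g x) + nu / x * (f x - g x) + (2 * nu + 1) / x * g x + p x).
Proof.
  intros S hx.
  replace (- (f x - g x) + nu / x * (f x - g x) + (2 * nu + 1) / x * g x + p x)
    with ((nu / x * f x + g x + p x) - (f x - (nu + 1) / x * g x)) by (field; lra).
  apply (is_derive_minus f g).
  - apply (system_derive_f _ _ _ _ _ S x hx).
  - apply (system_derive_g _ _ _ _ _ S x hx).
Qed.

(** Here [d' + (1 - nu/x) d = (2 nu + 1) g / x + p >= 0]; the weight
    [exp x * x^(- nu)] is harmless at 0 because [nu < mu + 1]. *)
Lemma difference_nonneg (mu nu : R) (f g p : R -> R) :
  lommel_system mu nu f g p -> - (1 / 2) < nu -> nu < mu + 1 ->
  forall x, 0 < x -> 0 <= f x - g x.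
Proof.
  intros S h1 h2.
  destruct (system_near_0 _ _ _ _ _ S) as [M [hM hnear]].
  apply (nonneg_of_weighted_derive (- nu) (mu + 2) M _
    (fun x => - (f x - g x) + nu / x * (f x - g x) + (2 * nu + 1) / x * g x + p x)).
  - lra.
  - lra.
  - intros x hx. apply (is_derive_difference mu); trivial.
  - intros x hx.
    assert (hg := system_g_pos _ _ _ _ _ S x hx).
    assert (hp := system_p_nonneg _ _ _ _ _ S x hx).
    assert (0 <= (2 * nu + 1) / x * g x).
    { apply Rmult_le_pos; [left; apply Rdiv_lt_0_compat |]; lra. }
    unfold Rdiv in *. lra.
  - intros x hx.
    assert (hf := system_f_pos _ _ _ _ _ S x (proj1 hx)).
    destruct (hnear x hx). lra.
Qed.

(** With [y = x d - (nu + 1/2) g] the system gives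
    [y' + y = d / 2 + (nu + 1/2) (nu + 1) g / x + x p], all terms of which are
    nonnegative. *)
Lemma difference_lower (mu nu : R) (f g p : R -> R) :
  lommel_system mu nu f g p ->
  - (3 / 2) < mu -> - (1 / 2) < nu -> nu < mu + 1 ->
  forall x, 0 < x -> 0 <= x * (f x - g x) - (nu + 1 / 2) * g x.
Proof.
  intros S h0 h1 h2.
  assert (hdiff := difference_nonneg mu nu f g p S h1 h2).
  destruct (system_near_0 _ _ _ _ _ S) as [M [hM hnear]].
  apply (nonneg_of_weighted_derive 0 (mu + 2) ((nu + 1 / 2) * M) _
    (fun x => (f x - g x) + x * (- (f x - g x) + nu / x * (f x - g x)
       + (2 * nu + 1) / x * g x + p x)
       - (nu + 1 / 2) * (f x - (nu + 1) / x * g x))).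
  - apply Rmult_le_pos; lra.
  - lra.
  - intros x hx.
    apply (is_derive_minus (fun u => u * (f u - g u)) (fun u => (nu + 1 / 2) * g u)).
    + replace (f x - g x + x * (- (f x - g x) + nu / x * (f x - g x)
         + (2 * nu + 1) / x * g x + p x))
        with (1 * (f x - g x) + x * (- (f x - g x) + nu / x * (f x - g x)
         + (2 * nu + 1) / x * g x + p x)) by ring.
      apply (is_derive_mult (fun u => u) (fun u => f u - g u) x).
      * apply (is_derive_id x).
      * apply (is_derive_difference mu); trivial.
      * intros; apply Rmult_comm.
    + apply (is_derive_scal g), (system_derive_g _ _ _ _ _ S x hx).
  - intros x hx.
    assert (hd := hdiff x hx).
    assert (hg := system_g_pos _ _ _ _ _ S x hx).
    assert (hp := system_p_nonneg _ _ _ _ _ S x hx).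
    match goal with |- 0 <= ?e => replace e with
      (/ 2 * (f x - g x) + (nu + 1 / 2) * (nu + 1) / x * g x + x * p x) by (field; lra) end.
    assert (0 <= x * p x) by (apply Rmult_le_pos; lra).
    assert (0 <= (nu + 1 / 2) * (nu + 1) / x * g x).
    { apply Rmult_le_pos; [left; apply Rdiv_lt_0_compat; nra | lra]. }
    lra.
  - intros x hx.
    assert (hd := hdiff x (proj1 hx)).
    destruct (hnear x hx) as [_ hg].
    assert (0 <= x * (f x - g x)) by (apply Rmult_le_pos; lra).
    assert ((nu + 1 / 2) * g x <= (nu + 1 / 2) * (M * Rpower x (mu + 2)))
      by (apply Rmult_le_compat_l; lra).
    lra.
Qed.

(** With [y = s g - x d] the system gives
    [y' + (1 + (mu + 2)/x) y = (2 mu + 5) g + (s (mu - nu + 1) g - x^2 p) / x]: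
    the source works against the claim, but it is absorbed by the first term of
    [g]. *)
Lemma difference_upper (mu nu : R) (f g p : R -> R) :
  lommel_system mu nu f g p ->
  - (3 / 2) < mu -> - (1 / 2) < nu -> nu < mu + 1 ->
  forall x, 0 < x -> 0 <= (mu + nu + 3) * g x - x * (f x - g x).
Proof.
  intros S h0 h1 h2.
  destruct (system_near_0 _ _ _ _ _ S) as [M [hM hnear]].
  apply (nonneg_of_weighted_derive (mu + 2) (mu + 2) M _
    (fun x => (mu + nu + 3) * (f x - (nu + 1) / x * g x)
       - ((f x - g x) + x * (- (f x - g x) + nu / x * (f x - g x)
       + (2 * nu + 1) / x * g x + p x)))).
  - lra.
  - lra.
  - intros x hx.
    apply (is_derive_minus (fun u => (mu + nu + 3) * g u) (fun u => u * (f u - g u))).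
    + apply (is_derive_scal g), (system_derive_g _ _ _ _ _ S x hx).
    + replace (f x - g x + x * (- (f x - g x) + nu / x * (f x - g x)
         + (2 * nu + 1) / x * g x + p x))
        with (1 * (f x - g x) + x * (- (f x - g x) + nu / x * (f x - g x)
         + (2 * nu + 1) / x * g x + p x)) by ring.
      apply (is_derive_mult (fun u => u) (fun u => f u - g u) x).
      * apply (is_derive_id x).
      * apply (is_derive_difference mu); trivial.
      * intros; apply Rmult_comm.
  - intros x hx.
    assert (hg := system_g_pos _ _ _ _ _ S x hx).
    assert (hp := system_p_le _ _ _ _ _ S x hx).
    match goal with |- 0 <= ?e => replace e with
      ((2 * mu + 5) * g x
       + / x * ((mu + nu + 3) * (mu - nu + 1) * g x - x ^ 2 * p x)) by (field; lra) end.
    apply Rplus_le_le_0_compat.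
    + apply Rmult_le_pos; lra.
    + apply Rmult_le_pos; [left; apply Rinv_0_lt_compat; lra | lra].
  - intros x hx.
    destruct (hnear x hx) as [hf _].
    assert (hg := system_g_pos _ _ _ _ _ S x (proj1 hx)).
    assert (hfp := system_f_pos _ _ _ _ _ S x (proj1 hx)).
    assert (0 <= (mu + nu + 3) * g x) by (apply Rmult_le_pos; lra).
    assert (0 <= x * g x) by (apply Rmult_le_pos; lra).
    assert (x * f x <= x * (M * Rpower x (mu + 1))) by (apply Rmult_le_compat_l; lra).
    replace (mu + 2) with (mu + 1 + 1) by ring.
    rewrite Rpower_succ by lra. lra.
Qed.

(** The derivative is expressed in [g] and [f - g], rather than [g] and [f],
    because both are nonnegative and the two-sided bounds on [f - g] then allow
    a deficit in the coefficient of one to be paid by the other. *)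
Lemma is_derive_trial (beta mu nu : R) (f g p q dq w dw : R -> R) (x : R) :
  lommel_system mu nu f g p -> 0 < x ->
  is_derive q x (dq x) -> is_derive w x (dw x) ->
  is_derive (fun u => exp (- beta * u) * Rpower u nu
      * (q u * (f u - g u) + w u * g u)) x
    (exp (- beta * x) * Rpower x nu *
     (g x * ((2 * nu + 1) * q x / x - w x / x + (1 - beta) * w x + dw x)
      + (f x - g x) * (2 * nu * q x / x - (1 + beta) * q x + dq x + w x)
      + q x * p x)).
Proof.
  intros S hx hq hw.
  set (dd := - (f x - g x) + nu / x * (f x - g x) + (2 * nu + 1) / x * g x + p x).
  set (dg := f x - (nu + 1) / x * g x).
  assert (hy : is_derive (fun u => q u * (f u - g u) + w u * g u) x
    ((dq x * (f x - g x) + q x * dd) + (dw x * g x + w x * dg))).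
  { apply (is_derive_plus (fun u => q u * (f u - g u)) (fun u => w u * g u)).
    - apply (is_derive_mult q (fun u => f u - g u)); trivial.
      + apply (is_derive_difference mu); trivial.
      + intros; apply Rmult_comm.
    - apply (is_derive_mult w g); trivial.
      + apply (system_derive_g _ _ _ _ _ S x hx).
      + intros; apply Rmult_comm. }
  assert (h := is_derive_weighted (- beta) nu _ x _ hx hy).
  match goal with |- is_derive _ _ ?e =>
    match type of h with is_derive _ _ ?e' => replace e with e' end end; [exact h |].
  f_equal. unfold dd, dg. field. lra.
Qed.

(** A trial function whose derivative dominates the integrand bounds the
    integral; positivity of the trial function replaces its limit at 0. *)
Lemma trial_bound (beta mu nu : R) (f g p q dq w dw : R -> R) (C : R) :
  lommel_system mu nu f g p ->
  - (3 / 2) < mu -> - (1 / 2) < nu -> nu < mu + 1 ->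
  (forall x, 0 < x -> is_derive q x (dq x)) ->
  (forall x, 0 < x -> is_derive w x (dw x)) ->
  (forall x, 0 < x -> 0 <= q x) ->
  (forall x, 0 < x -> 0 <= w x) ->
  (forall x, 0 < x -> f x <=
      g x * ((2 * nu + 1) * q x / x - w x / x + (1 - beta) * w x + dw x)
      + (f x - g x) * (2 * nu * q x / x - (1 + beta) * q x + dq x + w x)) ->
  (forall x, 0 < x -> q x * (mu + nu + 3) / x + w x <= C) ->
  forall x, 0 < x ->
    exists l, is_RInt_gen (fun u => exp (- beta * u) * Rpower u nu * f u)
        (at_right 0) (at_point x) l
      /\ l <= C * (exp (- beta * x) * Rpower x nu * g x).
Proof.
  intros S h0 h1 h2 hq hw hq0 hw0 hsuper hC x hx.
  set (phi := fun u => exp (- beta * u) * Rpower u nu * f u).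
  set (U := fun u => exp (- beta * u) * Rpower u nu
      * (q u * (f u - g u) + w u * g u)).
  assert (hE : forall u, 0 < exp (- beta * u) * Rpower u nu)
    by (intros; apply Rmult_lt_0_compat; apply exp_pos).
  assert (hc : forall u, 0 < u -> continuous phi u).
  { intros u hu. apply (ex_derive_continuous phi). eexists.
    apply is_derive_weighted; trivial.
    apply (system_derive_f _ _ _ _ _ S u hu). }
  assert (hU0 : forall u, 0 < u -> 0 <= U u).
  { intros u hu.
    assert (hg := system_g_pos _ _ _ _ _ S u hu).
    assert (hd := difference_nonneg _ _ _ _ _ S h1 h2 u hu).
    apply Rmult_le_pos; [left; apply hE |].
    apply Rplus_le_le_0_compat; apply Rmult_le_pos; auto; lra. }
  assert (hUC : U x <= C * (exp (- beta * x) * Rpower x nu * g x)).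
  { assert (hg := system_g_pos _ _ _ _ _ S x hx).
    assert (hd := difference_upper _ _ _ _ _ S h0 h1 h2 x hx).
    replace (C * (exp (- beta * x) * Rpower x nu * g x))
      with (exp (- beta * x) * Rpower x nu * (g x * C)) by ring.
    apply Rmult_le_compat_l; [left; apply hE |].
    apply Rle_trans with (g x * (q x * (mu + nu + 3) / x + w x)).
    - assert (h : 0 <= q x / x * ((mu + nu + 3) * g x - x * (f x - g x))).
      { apply Rmult_le_pos; [| lra].
        apply Rmult_le_pos; [auto | left; apply Rinv_0_lt_compat; trivial]. }
      replace (q x / x * ((mu + nu + 3) * g x - x * (f x - g x))) with
        (q x * (mu + nu + 3) / x * g x - q x * (f x - g x)) in h by (field; lra).
      lra.
    - apply Rmult_le_compat_l; [lra | auto]. }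
  destruct (is_RInt_gen_at_right_of_bounded phi x (U x)) as [l [hl [hlU _]]]; trivial.
  - intros u hu. apply Rmult_le_pos; [left; apply hE |].
    left. apply (system_f_pos _ _ _ _ _ S u hu).
  - intros e he. apply Rle_trans with (U x - U e); [| assert (h := hU0 e (proj1 he)); lra].
    eapply RInt_le_of_derive; trivial; try lra.
    + intros u hu. apply (is_derive_trial beta mu nu f g p q dq w dw u); auto.
    + intros u hu. assert (hu0 : 0 < u) by lra.
      apply Rmult_le_compat_l; [left; apply hE |].
      assert (hp := system_p_nonneg _ _ _ _ _ S u hu0).
      assert (0 <= q u * p u) by (apply Rmult_le_pos; auto).
      specialize (hsuper u hu0). lra.
  - exists l. split; [exact hl | lra].
Qed.

(** * The two choices of trial function *)

(** With the trial function [C exp (- beta x) x^nu g] the required inequality is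
    a combination, with coefficients [beta C] and [(1 - beta) C - 1], of
    [(nu + 1/2) g <= x (f - g)] and [s g <= x f]; up to a positive factor the remainder is
    [((nu - 1/2) beta + (mu - nu + 1) (1 - beta)) g], which is where [1/2 <= nu]
    is used. *)
Lemma integral_bound_large_order (mu nu beta : R) (f g p : R -> R) :
  lommel_system mu nu f g p ->
  - (3 / 2) < mu -> 1 / 2 <= nu -> nu < mu + 1 -> 0 < beta -> beta < 1 ->
  forall x, 0 < x ->
    exists l, is_RInt_gen (fun u => exp (- beta * u) * Rpower u nu * f u)
        (at_right 0) (at_point x) l
      /\ l <= (mu + nu + 3) / ((2 * nu + 1) * (1 - beta))
             * (exp (- beta * x) * Rpower x nu * g x).
Proof.
  intros S h0 h1 h2 hb0 hb1.
  set (s := mu + nu + 3). set (C := s / ((2 * nu + 1) * (1 - beta))).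
  assert (hC0 : 0 < C).
  { apply Rdiv_lt_0_compat; [unfold s; lra | apply Rmult_lt_0_compat; lra]. }
  assert (hCe : (2 * nu + 1) * ((1 - beta) * C) = s) by (unfold C; field; lra).
  assert (hCe1 : 1 < (1 - beta) * C).
  { apply Rmult_lt_reg_l with (2 * nu + 1); [lra |]. rewrite hCe. unfold s. lra. }
  assert (hrest : 0 <= C * ((nu + 1 / 2) * beta - 1 + s * (1 - beta)) - s).
  { apply Rmult_le_reg_l with (1 - beta); [lra |].
    replace ((1 - beta) * (C * ((nu + 1 / 2) * beta - 1 + s * (1 - beta)) - s))
      with ((1 - beta) * C * ((nu + 1 / 2) * beta - 1 + s * (1 - beta) - (2 * nu + 1) * (1 - beta)))
      by (rewrite <- hCe at 3; ring).
    rewrite Rmult_0_r. apply Rmult_le_pos; [lra |]. unfold s. nra. }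
  apply (trial_bound beta mu nu f g p (fun _ => 0) (fun _ => 0) (fun _ => C) (fun _ => 0));
    trivial; try lra.
  - intros x hx. apply (is_derive_const 0 x).
  - intros x hx. apply (is_derive_const C x).
  - intros; lra.
  - intros; lra.
  - intros x hx. fold s in S.
    assert (hlow := difference_lower mu nu f g p S h0 ltac:(lra) h2 x hx).
    assert (hratio := system_ratio _ _ _ _ _ S x hx). fold s in hratio.
    assert (hg := system_g_pos _ _ _ _ _ S x hx).
    apply Rmult_le_reg_l with x; trivial. apply Rminus_le_0.
    match goal with |- 0 <= ?e => replace e with
      (beta * C * (x * (f x - g x) - (nu + 1 / 2) * g x)
       + ((1 - beta) * C - 1) * (x * f x - s * g x)
       + (C * ((nu + 1 / 2) * beta - 1 + s * (1 - beta)) - s) * g x) by (field; lra) end.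
    repeat apply Rplus_le_le_0_compat; apply Rmult_le_pos; try lra.
    apply Rmult_le_pos; lra.
  - intros x hx. right. field. lra.
Qed.

Lemma is_derive_saturating (a eta x : R) : 0 <= eta -> 0 < x ->
  is_derive (fun u => a * u / (1 + eta * u)) x (a / (1 + eta * x) ^ 2).
Proof.
  intros heta hx. assert (0 <= eta * x) by (apply Rmult_le_pos; lra).
  auto_derive; [| field]; lra.
Qed.

(** Trial function with [q = kap x / (1 + eta x)] and [w = om x / (1 + eta x)].
    The value [kap = 1 / (2 nu + 1)] is forced at [x = 0] by the coefficient of
    [f - g], and [om] is the value for which the excess of that coefficient over 1 is of
    second order, namely [kap (eta x / (1 + eta x))^2].  The lower bound
    [(nu + 1/2) g <= x (f - g)] lets this excess pay for the coefficient of [g];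
    what is left is nonnegative for [eta = (1 - beta) / (nu + 3/2)].  The two
    lower bounds on [K] come from the values of [q s / x + w] at [x = 0] and at
    infinity, between which it is monotone. *)
Lemma integral_bound_small_order (mu nu beta K : R) (f g p : R -> R) :
  lommel_system mu nu f g p ->
  - (3 / 2) < mu -> - (1 / 2) < nu -> nu < 1 / 2 -> nu < mu + 1 ->
  0 < beta -> beta < 1 -> mu + nu + 3 <= K -> 3 * (nu + 1 / 2) + 2 <= K ->
  forall x, 0 < x ->
    exists l, is_RInt_gen (fun u => exp (- beta * u) * Rpower u nu * f u)
        (at_right 0) (at_point x) l
      /\ l <= K / ((2 * nu + 1) * (1 - beta))
             * (exp (- beta * x) * Rpower x nu * g x).
Proof.
  intros S h0 h1 h1' h2 hb0 hb1 hKs hKn.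
  set (s := mu + nu + 3) in *. set (eps := 1 - beta).
  set (kap := 1 / (2 * nu + 1)).
  set (eta := eps / (nu + 3 / 2)).
  set (om := kap * (2 - eps) + eta * (1 + kap)).
  assert (hkap : 0 < kap) by (apply Rdiv_lt_0_compat; lra).
  assert (heps : 0 < eps) by (unfold eps; lra).
  assert (heta : 0 < eta) by (apply Rdiv_lt_0_compat; lra).
  assert (hom : eta < om).
  { unfold om. assert (0 < kap * (2 - eps)) by (apply Rmult_lt_0_compat; unfold eps; lra).
    assert (0 < eta * kap) by (apply Rmult_lt_0_compat; lra). lra. }
  assert (hD : forall x, 0 < x -> 0 < 1 + eta * x).
  { intros x hx. assert (0 < eta * x) by (apply Rmult_lt_0_compat; lra). lra. }
  apply (trial_bound beta mu nu f g p
    (fun x => kap * x / (1 + eta * x)) (fun x => kap / (1 + eta * x) ^ 2)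
    (fun x => om * x / (1 + eta * x)) (fun x => om / (1 + eta * x) ^ 2)); trivial.
  - intros x hx. apply is_derive_saturating; lra.
  - intros x hx. apply is_derive_saturating; lra.
  - intros x hx. left. apply Rdiv_lt_0_compat; [apply Rmult_lt_0_compat |]; auto.
  - intros x hx. left. apply Rdiv_lt_0_compat; [apply Rmult_lt_0_compat |]; auto; lra.
  - intros x hx. specialize (hD x hx).
    assert (hlow := difference_lower mu nu f g p S h0 h1 h2 x hx).
    assert (hg := system_g_pos _ _ _ _ _ S x hx).
    apply Rminus_le_0.
    match goal with |- 0 <= ?e => replace e with
      (kap * eta ^ 2 * x / (1 + eta * x) ^ 2 * (x * (f x - g x) - (nu + 1 / 2) * g x)
       + x / (1 + eta * x) * (eta * eps / 2 + (om - eta / 2) * (eta ^ 2 * x / (1 + eta * x))) * g x) end.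
    + assert (0 <= eta ^ 2 * x / (1 + eta * x)).
      { left. apply Rdiv_lt_0_compat; trivial. apply Rmult_lt_0_compat; [apply pow_lt |]; trivial. }
      apply Rplus_le_le_0_compat; apply Rmult_le_pos; try lra.
      * left. apply Rdiv_lt_0_compat; [| apply pow_lt; trivial].
        apply Rmult_lt_0_compat; [apply Rmult_lt_0_compat; [| apply pow_lt] |]; trivial.
      * apply Rmult_le_pos; [left; apply Rdiv_lt_0_compat; trivial |].
        apply Rplus_le_le_0_compat; [| apply Rmult_le_pos; lra].
        assert (0 < eta * eps) by (apply Rmult_lt_0_compat; trivial). lra.
    + assert (heps' : eps = eta * (nu + 3 / 2)) by (unfold eta; field; lra).
      assert (hbeta : beta = 1 - eta * (nu + 3 / 2)) by (unfold eps in heps'; lra).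
      unfold om, kap. rewrite heps', hbeta. clearbody eta. field. lra.
  - intros x hx. specialize (hD x hx).
    replace (kap * x / (1 + eta * x) * (mu + nu + 3) / x + om * x / (1 + eta * x))
      with ((kap * s + om * x) / (1 + eta * x)) by (unfold s; field; lra).
    apply Rle_div_l; [lra |].
    replace (K / ((2 * nu + 1) * eps) * (1 + eta * x))
      with (kap * (K / eps) + kap * (K / (nu + 3 / 2)) * x)
      by (unfold kap, eta; field; lra).
    apply Rplus_le_compat.
    + apply Rmult_le_compat_l; [lra |]. apply Rle_div_r; [lra |].
      assert (eps < 1) by (unfold eps; lra). assert (0 < s) by (unfold s; lra). nra.
    + apply Rmult_le_compat_r; [lra |].
      replace om with (kap * (2 + eps * (nu + 1 / 2) / (nu + 3 / 2)))
        by (unfold om, kap, eta; field; lra).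
      apply Rmult_le_compat_l; [lra |]. apply Rle_div_r; [lra |].
      replace ((2 + eps * (nu + 1 / 2) / (nu + 3 / 2)) * (nu + 3 / 2))
        with (2 * (nu + 3 / 2) + eps * (nu + 1 / 2)) by (field; lra).
      assert (eps < 1) by (unfold eps; lra). nra.
Qed.

(** * The constants, and the theorem *)

Lemma lommel_A_gt (mu nu r : R) :
  (2 * r - (mu - nu)) ^ 2 < (mu - nu) ^ 2 + 8 * (mu + nu + 3) -> r < lommel_A mu nu.
Proof.
  intros h. unfold lommel_A.
  assert (2 * r - (mu - nu) < sqrt ((mu - nu) ^ 2 + 8 * (mu + nu + 3))); [| lra].
  apply Rle_lt_trans with (sqrt ((2 * r - (mu - nu)) ^ 2)).
  - rewrite <- Rsqr_pow2, sqrt_Rsqr_abs. apply Rle_abs.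
  - apply sqrt_lt_1_alt. split; [apply pow2_ge_0 | exact h].
Qed.

Lemma lommel_A_pos (mu nu : R) : 0 < mu + nu + 3 -> 0 < lommel_A mu nu.
Proof. intros h. apply lommel_A_gt. nra. Qed.

(** With [n = nu + 1/2] and [m = mu - nu] the claim is [n - m < A].  If
    [2 n < 3 m] it follows from [A >= m / 2]; otherwise, squaring, it becomes
    [(n - m) (n - 2 m) < 2 (2 n + 2 + m)], which is convex in [m] and holds at
    both ends of the range [-1 <= m <= 2 n / 3]. *)
Lemma lommel_A_small_order (mu nu : R) :
  - (1 / 2) < nu -> nu < 1 / 2 -> nu < mu + 1 ->
  3 * (nu + 1 / 2) + 2 < mu + nu + 3 + lommel_A mu nu.
Proof.
  intros h1 h2 h3.
  destruct (Rlt_le_dec (2 * (nu + 1 / 2)) (3 * (mu - nu))) as [hm | hm].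
  - unfold lommel_A.
    assert (h := sqrt_pos ((mu - nu) ^ 2 + 8 * (mu + nu + 3))). lra.
  - cut (nu + 1 / 2 - (mu - nu) < lommel_A mu nu); [lra |].
    apply lommel_A_gt.
    set (n := nu + 1 / 2) in *. set (m := mu - nu) in *.
    replace (mu + nu + 3) with (2 * n + 2 + m) by (unfold n, m; field).
    assert (0 < n < 1) by (unfold n; lra). assert (-1 < m) by (unfold m; lra).
    assert (0 <= (2 * n - 3 * m) * (m + 1)) by (apply Rmult_le_pos; lra).
    assert (0 < n * (m + 1)) by (apply Rmult_lt_0_compat; lra).
    assert (0 < n * (1 - n)) by (apply Rmult_lt_0_compat; lra).
    nra.
Qed.

Theorem theorem2p2 (mu nu beta : R)
  (hmu : - (3 / 2) < mu)
  (hnu1 : - (1 / 2) < nu) (hnu2 : nu < mu + 1)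
  (hbeta0 : 0 < beta) (hbeta1 : beta < 1) :
  forall x : R, 0 < x ->
    ex_RInt_gen (lommel_integrand beta mu nu) (at_right 0) (at_point x) /\
    RInt_gen (lommel_integrand beta mu nu) (at_right 0) (at_point x)
      < (mu + nu + 3 + lommel_A mu nu) / ((2 * nu + 1) * (1 - beta))
        * (exp (- beta * x) * Rpower x nu * lommel_t (mu + 1) (nu + 1) x) /\
    RInt_gen (lommel_integrand beta mu nu) (at_right 0) (at_point x)
      < (mu + nu + (9 + sqrt 17) / 2) / ((2 * nu + 1) * (1 - beta))
        * (exp (- beta * x) * Rpower x nu * lommel_t (mu + 1) (nu + 1) x).
Proof.
  intros x hx.
  assert (S := lommel_t_system mu nu hmu hnu1 hnu2).
  set (Y := exp (- beta * x) * Rpower x nu * lommel_t (mu + 1) (nu + 1) x).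
  assert (hY : 0 < Y).
  { apply Rmult_lt_0_compat; [apply Rmult_lt_0_compat; apply exp_pos |].
    apply (system_g_pos _ _ _ _ _ S x hx). }
  assert (hA := lommel_A_pos mu nu ltac:(lra)).
  assert (h17 : 3 < sqrt 17).
  { rewrite <- (sqrt_Rsqr 3) by lra. apply sqrt_lt_1_alt. unfold Rsqr. lra. }
  assert (hden : 0 < / ((2 * nu + 1) * (1 - beta)))
    by (apply Rinv_0_lt_compat, Rmult_lt_0_compat; lra).
  assert (core : exists K l,
    K < mu + nu + 3 + lommel_A mu nu /\ K < mu + nu + (9 + sqrt 17) / 2 /\
    is_RInt_gen (lommel_integrand beta mu nu) (at_right 0) (at_point x) l /\
    l <= K / ((2 * nu + 1) * (1 - beta)) * Y).
  { destruct (Rlt_le_dec nu (1 / 2)) as [hnu | hnu].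
    - assert (hA' := lommel_A_small_order mu nu hnu1 hnu hnu2).
      destruct (integral_bound_small_order mu nu beta
        (Rmax (mu + nu + 3) (3 * (nu + 1 / 2) + 2)) _ _ _ S hmu hnu1 hnu hnu2 hbeta0 hbeta1
        (Rmax_l _ _) (Rmax_r _ _) x hx) as [l [hl hle]].
      exists (Rmax (mu + nu + 3) (3 * (nu + 1 / 2) + 2)), l.
      repeat split; trivial; apply Rmax_lub_lt; lra.
    - destruct (integral_bound_large_order mu nu beta _ _ _ S hmu hnu hnu2 hbeta0 hbeta1 x hx)
        as [l [hl hle]].
      exists (mu + nu + 3), l. repeat split; trivial; lra. }
  destruct core as [K [l [hK1 [hK2 [hl hle]]]]].
  assert (hstrict : forall K', K < K' -> l < K' / ((2 * nu + 1) * (1 - beta)) * Y).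
  { intros K' hK'. apply Rle_lt_trans with (1 := hle).
    apply Rmult_lt_compat_r; trivial. apply Rmult_lt_compat_r; trivial. }
  rewrite (is_RInt_gen_unique _ _ hl).
  split; [exists l; exact hl | split; apply hstrict; trivial].
Qed.
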